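(* Let $i\ge 3$ and $k\ge 3$ be integers. Then: (a) $n_3(F_i,F_{i+2},F_{i+k})=\tfrac12\bigl(7F_iF_{i+2}-F_i-F_{i+2}+1\bigr)$ whenever $k\ge i+3$; (b) $n_3(F_i,F_{i+2},F_{2i})=\tfrac12\bigl((5F_i-1)F_{i+2}-F_i+1\bigr)-2F_iF_{i-2}$; (c) $n_3(F_i,F_{i+2},F_{2i-1})=\tfrac12\bigl((F_i+4F_{i-1}-1)F_{i+2}-F_i+1\bigr)-2F_{i-1}F_{i-3}$ for $i\ge 4$; (d) $n_3(F_i,F_{i+2},F_{2i-2})=\tfrac12\bigl((3F_i-1)F_{i+2}-F_i+1\bigr)-(8F_i-15F_{i-2})F_{i-4}$ for $i\ge 5$; (e) if $r=\lfloor (F_i-1)/F_k\rfloor\ge 3$ (equivalently $k\le i-3$), then $$n_3(F_i,F_{i+2},F_{i+k})=\tfrac12\bigl((F_i+6F_k-1)F_{i+2}-F_i+1\bigr)-\tfrac12\bigl(2rF_i-(r+4)(r-3)F_k\bigr)F_{k-2}.$$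
   Context: Fibonacci numbers: $F_0=0$, $F_1=1$, $F_n=F_{n-1}+F_{n-2}$. For positive integers $a_1,\dots,a_l$ with $\gcd(a_1,\dots,a_l)=1$ and an integer $n$, let $d(n;a_1,\dots,a_l)$ be the number of tuples $(x_1,\dots,x_l)$ of nonnegative integers with $a_1x_1+\dots+a_lx_l=n$. For a nonnegative integer $p$, the $p$-Sylvester number $n_p(a_1,\dots,a_l)$ is the number of nonnegative integers $n$ with $d(n;a_1,\dots,a_l)\le p$. *)

(* Defs.v *)
From mathcomp Require Import all_boot all_order all_algebra.
Set Implicit Arguments. Unset Strict Implicit. Unset Printing Implicit Defensive.

Fixpoint fib (n : nat) : nat :=
  match n with
  | 0 => 0
  | 1 => 1
  | (m.+1 as p).+1 => fib p + fib m
  end.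

(* d n a = number of tuples (x_1,...,x_l) of nonnegative integers with
   a_1 x_1 + ... + a_l x_l = n, for a = [:: a_1; ...; a_l] of positive
   integers.  Recursion on the first coefficient: x_1 ranges over
   0 .. n %/ a_1. *)
Fixpoint dnum (n : nat) (a : seq nat) : nat :=
  match a with
  | [::] => (n == 0)
  | a1 :: s => \sum_(x < (n %/ a1).+1) dnum (n - a1 * x) s
  end.

(* N is the p-Sylvester number n_p(a): the set {n : nat | dnum n a <= p}
   is finite and has exactly N elements (it is contained in [0, B) and
   has N elements there). *)
Definition is_sylvester_number (p : nat) (a : seq nat) (N : nat) : Prop :=
  exists B : nat,
    (forall n, B <= n -> p < dnum n a) /\
    count (fun n => dnum n a <= p) (iota 0 B) = N.

(* Main.v *)
Require Import Defs.
From mathcomp Require Import all_boot all_order all_algebra.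
From mathcomp Require Import zify ring lra.
Set Implicit Arguments. Unset Strict Implicit. Unset Printing Implicit Defensive.

(** Write a = F_i, b = F_(i+2), c = F_(i+k), K = F_k, s = F_(k-2), so that
    c + s a = K b.  For n in the class of t b modulo a (0 <= t < a), a
    representation n = a x + b y + c z is determined by (y, z), and
    y + K z = t + a w for some w >= 0; then b y + c z = t b + a (w b - s z).
    Hence the least n in this class with at least p + 1 representations is
    t b + a V_t, where V_t is the (p+1)-st smallest value of w b - s z over the
    pairs (w, z) with K z <= t + a w, and
    n_p = (a - 1) (b - 1) / 2 + sum_(t < a) V_t.
    For p = 3 the four smallest pairs are explicit: if K > 3 a they are
    (0, 0), ..., (3, 0); otherwise w <= 2 and, for the relevant w, z takes the
    largest values allowed by K z <= t + a w. *)

(** * Representations as explicit lists, and their number along n, n + c, n + 2 c, .. *)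

Definition dot (a v : seq nat) : nat := sumn [seq p.1 * p.2 | p <- zip a v].


(** Follows the recursion of [dnum], so that the length of the list is [dnum n a] by
    construction. *)
Fixpoint reps (n : nat) (a : seq nat) : seq (seq nat) :=
  match a with
  | [::] => nseq (n == 0) [::]
  | c :: s => [seq x :: v | x <- iota 0 (n %/ c).+1, v <- reps (n - c * x) s]
  end.

Lemma size_reps n a : size (reps n a) = dnum n a.
Proof.
elim: a n => [|c a IH] n; first by rewrite size_nseq.
rewrite [LHS]size_allpairs_dep sumnE big_map.
rewrite [RHS]/= -(big_mkord xpredT (fun x => dnum (n - c * x) a)) /index_iota subn0.
by apply: eq_bigr => x _; rewrite IH.
Qed.

Lemma uniq_reps n a : uniq (reps n a).
Proof.
elim: a n => [|c a IH] n; first by case: n.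
apply: allpairs_uniq_dep => [|x _|]; [exact: iota_uniq | exact: IH |].
by move=> [x v] [y w] _ _ /= [-> ->].
Qed.

Lemma mem_reps n a v : all (ltn 0) a ->
  (v \in reps n a) = (size v == size a) && (dot a v == n).
Proof.
elim: a n v => [|c a IH] n v.
  by case: v => [|x v]; rewrite mem_nseq /dot; case: n.
case/andP=> /= c_gt0 /IH {}IH.
have memE k : (k \in iota 0 (n %/ c).+1) = (c * k <= n).
  by rewrite mem_iota add0n ltnS leq_divRL // mulnC.
apply: (sameP (@flatten_mapP _ _ (fun x => [seq x :: u | u <- reps (n - c * x) a])
                (iota 0 (n %/ c).+1) v)).
apply: (iffP andP).
  case: v => [[]//|x w [/= sw /eqP dw]].
  rewrite /dot /= -/(dot a w) in dw.
  exists x; first by apply: (etrans (memE x)); lia.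
  by apply/mapP; exists w => //; rewrite IH; rewrite eqSS in sw; rewrite sw /=; apply/eqP; lia.
move=> [x]; rewrite memE => xlt /mapP[w]; rewrite IH => /andP[/eqP sw /eqP dw] -> /=.
by rewrite sw; split=> //; rewrite /dot /= -/(dot a w) dw; apply/eqP; lia.
Qed.

(** Bounds on [dnum] thereby become inclusions between duplicate-free lists, in either direction. *)
Lemma dnum_enum n a : all (ltn 0) a ->
  exists R : seq (seq nat), [/\ uniq R, size R = dnum n a &
    forall v, (v \in R) = (size v == size a) && (dot a v == n)].
Proof.
by move=> pos; exists (reps n a); split=> [||v]; rewrite ?uniq_reps ?size_reps ?mem_reps.
Qed.

(** Raising the first coordinate by 1 injects the representations of n into those of n + c. *)
Lemma leq_dnum_addn n c a : 0 < c -> dnum n (c :: a) <= dnum (n + c) (c :: a).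
Proof.
move=> c_gt0 /=; rewrite divnDr // divnn c_gt0 addn1 [X in _ <= X]big_ord_recl.
apply: leq_trans (leq_addl _ _); apply: eq_leq; apply: eq_bigr => x _.
by congr (dnum _ _); rewrite ?lift0 mulnS; lia.
Qed.

Lemma leq_dnum_addnM n q c a : 0 < c -> dnum n (c :: a) <= dnum (n + q * c) (c :: a).
Proof.
move=> c_gt0; elim: q => [|q IH]; first by rewrite addn0.
by rewrite mulSnr addnA; apply: leq_trans IH (leq_dnum_addn _ _ c_gt0).
Qed.

(** * Counting by residue classes modulo a *)

Lemma count_mod_iota a q r : r < a ->
  count (fun n => n %% a == r) (iota 0 (q * a + r)) = q.
Proof.
move=> ra; elim: q => [|q IH].
  rewrite mul0n; apply/eqP; rewrite -leqn0 leqNgt -has_count; apply/hasPn => n.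
  rewrite mem_iota add0n /= => nr; rewrite modn_small; lia.
rewrite mulSn -addnA iotaD count_cat add0n -[X in iota X (_ + _)]addn0 iotaDl count_map.
rewrite (eq_count (a2 := fun n => n %% a == r)) ?IH => [|n /=]; last by rewrite modnDl.
suff -> : count (fun n => n %% a == r) (iota 0 a) = 1 by [].
transitivity (count_mem r (iota 0 a)).
  apply: eq_in_count => n; rewrite mem_iota add0n /= => na.
  by rewrite modn_small.
by rewrite count_uniq_mem ?iota_uniq // mem_iota add0n ra.
Qed.

Lemma count_mod_ltn a m B : 0 < a -> m <= B ->
  count (fun n => (n %% a == m %% a) && (n < m)) (iota 0 B) = m %/ a.
Proof.
move=> a_gt0 mB; rewrite -(subnKC mB) iotaD count_cat add0n.
rewrite -[in X in _ = X](count_mod_iota (m %/ a) (ltn_pmod m a_gt0)) -divn_eq.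
rewrite -[RHS]addn0; congr (_ + _).
  by apply: eq_in_count => n; rewrite mem_iota add0n /= => nm; rewrite nm andbT.
apply/eqP; rewrite -leqn0 leqNgt -has_count; apply/hasPn => n.
by rewrite mem_iota => /andP[mn _] /=; rewrite [n < m]ltnNge mn andbF.
Qed.

Lemma modn_mul_inj a b t u : coprime a b -> t < a -> u < a ->
  b * t = b * u %[mod a] -> t = u.
Proof.
move=> co ta ua; wlog tu : t u ta ua / t <= u.
  move=> W; case/orP: (leq_total t u) => ?; first exact: W.
  by move=> e; apply/esym; apply: W.
move/esym/eqP; rewrite eqn_mod_dvd ?leq_mul2l ?tu ?orbT // -mulnBr Gauss_dvdr //.
move=> /dvdnP[[|q] e]; first lia.
nia.
Qed.

Lemma inj_modn_mul a b (a_gt0 : 0 < a) : coprime a b ->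
  injective (fun t : 'I_a => Ordinal (ltn_pmod (b * t) a_gt0)).
Proof.
move=> co t u /(congr1 val) /= e; apply: val_inj.
exact: modn_mul_inj co (ltn_ord t) (ltn_ord u) e.
Qed.

(* As [dnum] is nondecreasing along n, n + a, n + 2 a, ..., the residue class
   of [m t] contributes exactly [m t %/ a] integers. *)
Lemma sylvester_thresholds p a s b (m : nat -> nat) :
    0 < a -> coprime a b ->
    (forall t, t < a -> m t = b * t %[mod a]) ->
    (forall t, t < a -> p < dnum (m t) (a :: s)) ->
    (forall t, t < a -> a <= m t -> dnum (m t - a) (a :: s) <= p) ->
  is_sylvester_number p (a :: s) (\sum_(t < a) m t %/ a).
Proof.
move=> a_gt0 co mE m_gt m_le.
(* The last member of the class below [m t] is [m t - a], so by monotonicity the hypotheses at these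
   two points settle the whole class. *)
have thr t n : t < a -> n = m t %[mod a] -> (dnum n (a :: s) <= p) = (n < m t).
  move=> ta e; have [nm|mn] := ltnP n (m t).
    have /dvdnP[[|q] eq] : a %| m t - n by rewrite -eqn_mod_dvd ?(ltnW nm) //; apply/eqP.
      lia.
    have le : a <= m t by lia.
    apply: leq_trans (m_le t ta le).
    by rewrite (_ : m t - a = n + q * a) ?leq_dnum_addnM //; lia.
  have /dvdnP[q eq] : a %| n - m t by rewrite -eqn_mod_dvd //; apply/eqP.
  apply/negbTE; rewrite -ltnNge; apply: leq_trans (m_gt t ta) _.
  by rewrite (_ : n = m t + q * a) ?leq_dnum_addnM //; lia.
have inj := @inj_modn_mul a b a_gt0 co.
pose B := \max_(t < a) m t.
have mB (t : 'I_a) : m t <= B by apply: (leq_bigmax (F := fun t : 'I_a => m t)).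
exists B; split=> [n Bn|].
  have [g _ gK] := injF_bij inj.
  pose t := g (Ordinal (ltn_pmod n a_gt0)).
  have e : n = m t %[mod a].
    by rewrite mE // -[RHS]/(val (Ordinal (ltn_pmod (b * t) a_gt0))) gK.
  by rewrite ltnNge (thr t) // -leqNgt (leq_trans (mB t)).
(* The count is split by residue, and the residues are then reindexed by the permutation t -> b t
   mod a. *)
rewrite -sum1_count (partition_big (fun n => Ordinal (ltn_pmod n a_gt0)) xpredT) //=.
rewrite (reindex_inj inj) /=; apply: eq_bigr => t _.
rewrite sum1_count -(count_mod_ltn a_gt0 (mB t)); apply: eq_count => n /=.
rewrite -val_eqE /= -mE // andbC.
by case: eqP => //= e; rewrite (thr t).
Qed.

(** The remainders of the [m t] modulo a run once through 0, ..., a - 1, whose sum is C(a, 2). *)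
Lemma sum_divn_perm a b (m : nat -> nat) : 0 < a -> coprime a b ->
  (forall t, t < a -> m t = b * t %[mod a]) ->
  a * (\sum_(t < a) m t %/ a) + 'C(a, 2) = \sum_(t < a) m t.
Proof.
move=> a_gt0 co mE; rewrite -bin2_sum big_mkord.
have inj := @inj_modn_mul a b a_gt0 co.
rewrite [X in _ + X = _](reindex_inj inj) /= big_distrr -big_split /=.
by apply: eq_bigr => t _; rewrite -mE // mulnC -divn_eq.
Qed.

(** * From the smallest pairs (w, z) to the Sylvester number *)

Lemma modn_eq_of_addM a u v x y : u + x * a = v + y * a -> u = v %[mod a].
Proof. by move=> e; rewrite -(modnMDl x) addnC e addnC modnMDl. Qed.

(* [q t] is the (p+1)-st smallest pair (w, z) for the class of t b, and [L t]
   lists the p smaller ones; w1 b - s z1 < w2 b - s z2 is written without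
   subtraction. *)
Lemma sylvester_pairs p a b c K s (q : nat -> nat * nat) (L : nat -> seq (nat * nat)) :
    0 < a -> 0 < b -> 0 < c -> coprime a b -> c + s * a = K * b ->
    (forall t, t < a ->
      [/\ uniq (q t :: L t), size (L t) = p,
          {in q t :: L t, forall u, K * u.2 <= t + a * u.1},
          {in L t, forall u, u.1 * b + s * (q t).2 <= (q t).1 * b + s * u.2} &
          forall u, K * u.2 <= t + a * u.1 ->
            u.1 * b + s * (q t).2 < (q t).1 * b + s * u.2 -> u \in L t]) ->
  exists N, is_sylvester_number p [:: a; b; c] N /\
    (N%:R = (a%:R - 1) * (b%:R - 1) / 2 + (\sum_(t < a) (q t).1)%:R * b%:R
            - s%:R * (\sum_(t < a) (q t).2)%:R :> rat)%R.
Proof.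
move=> a_gt0 b_gt0 c_gt0 co cE H.
have pos : all (ltn 0) [:: a; b; c] by rewrite /= a_gt0 b_gt0 c_gt0.
(* A pair (w, z) fixes y, and then x as an exact quotient; the subtraction in [y] does not truncate
   when K z <= t + a w. *)
pose y t (u : nat * nat) := t + a * u.1 - K * u.2.
pose val t u := b * y t u + c * u.2.
pose rep n t u := [:: (n - val t u) %/ a; y t u; u.2].
have valE t u : K * u.2 <= t + a * u.1 -> val t u + s * u.2 * a = b * t + b * u.1 * a.
  move=> le; have yE : y t u + K * u.2 = t + a * u.1 by rewrite /y; lia.
  have := congr1 (muln b) yE; have := congr1 (muln u.2) cE.
  by rewrite /val; nia.
have ok t : t < a -> K * (q t).2 <= t + a * (q t).1.
  by case/H=> _ _ ok _ _; apply: ok; rewrite mem_head.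
pose m t := val t (q t).
have mE t : t < a -> m t = b * t %[mod a].
  by move=> /ok /valE; apply: modn_eq_of_addM.
exists (\sum_(t < a) m t %/ a); split.
  apply: (sylvester_thresholds a_gt0 co mE) => t ta.
    (* At [m t], the pair [q t] and the p pairs of [L t] yield p + 1 distinct representations. *)
    have [uL sL vL lL _] := H t ta; have [R [_ <- memR]] := dnum_enum (m t) pos.
    rewrite -sL; have -> : (size (L t)).+1 = size [seq rep (m t) t u | u <- q t :: L t].
      by rewrite size_map.
    apply: uniq_leq_size => [|_ /mapP[[w z] uin ->]].
      rewrite map_inj_in_uniq // => -[w z] [w' z'] /vL /= v1 /vL /= v2.
      rewrite /rep /y /= => -[_ e ez]; rewrite -{}ez in e v2 *.
      by congr pair; apply/eqP; rewrite -(eqn_pmul2l a_gt0); apply/eqP; lia.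
    have /= vu := vL _ uin; have vq := ok t ta.
    have /= le : (w, z).1 * b + s * (q t).2 <= (q t).1 * b + s * (w, z).2.
      by move: uin; rewrite inE => /orP[/eqP -> //|/lL].
    have [d dE] : exists d, w * b + s * (q t).2 + d = (q t).1 * b + s * z.
      by eexists; apply: subnKC le.
    have e : m t = val t (w, z) + d * a.
      have /= := valE t (w, z) vu; have := valE t (q t) vq; rewrite -/(m t).
      by have := congr1 (muln a) dE; clear; nia.
    rewrite memR /rep /dot /= e addKn mulnK // /val /=; apply/eqP; lia.
  (* At [m t - a], every representation comes from a pair of strictly smaller value than [q t],
     hence from one of the p pairs of [L t]. *)
  move=> am; have [uL sL vL lL cL] := H t ta; have [R [uR <- memR]] := dnum_enum (m t - a) pos.
  rewrite -sL -(size_map (rep (m t - a) t)); apply: uniq_leq_size uR _ => v.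
  rewrite memR; case: v => [|x [|y' [|z [|? ?]]]] //= /eqP.
  rewrite /dot /= => e.
  have eq : b * (y' + K * z) + x * a = b * t + b * (q t).1 * a + s * z * a - s * (q t).2 * a - a.
    have := valE t (q t) (ok t ta); have := congr1 (muln z) cE; rewrite -/(m t) !mulnDr; lia.
  pose w := (y' + K * z) %/ a.
  have tE : (y' + K * z) %% a = t.
    apply: (modn_mul_inj co) => //; first exact: ltn_pmod.
    rewrite modnMmr -(mE t ta).
    apply: (@modn_eq_of_addM _ _ _ x.+1 (s * z)).
    by have := congr1 (muln z) cE; rewrite mulnDr; lia.
  have wE : y' + K * z = t + a * w by rewrite -{1}tE [RHS]addnC [a * w]mulnC -divn_eq.
  have okw : K * z <= t + a * w by lia.
  have yE : y t (w, z) = y' by rewrite /y /=; lia.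
  apply/mapP; exists (w, z); last first.
    by rewrite /rep yE /val yE /= -e; congr [:: _, _, _ & _]; rewrite addn0 addnK mulKn.
  apply: cL => //=; rewrite -(ltn_pmul2r a_gt0) !mulnDl.
  by have := valE t (q t) (ok t ta); have := valE t (w, z) okw; rewrite -/(m t) {1}/val yE /=; lia.
have := sum_divn_perm a_gt0 co mE.
have : \sum_(t < a) m t + s * a * (\sum_(t < a) (q t).2)
     = b * 'C(a, 2) + b * a * (\sum_(t < a) (q t).1).
  rewrite -bin2_sum big_mkord !big_distrr -!big_split /=.
  by apply: eq_bigr => t _; have := valE t (q t) (ok t (ltn_ord t)); rewrite -/(m t); lia.
(* Since 2 C(a, 2) = a (a - 1), the binomial disappears and a common factor a cancels. *)
move=> e1 e2; have := mul_bin_diag a 1; rewrite bin1 => e3.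
set N := \sum_(t < a) m t %/ a in e2 *; set W := \sum_(t < a) _.1 in e1 *.
set Z := \sum_(t < a) _.2 in e1 *.
have e4 : 2 * a * N + a * a.-1 + 2 * s * a * Z = b * (a * a.-1) + 2 * b * a * W.
  by rewrite e3; lia.
have {}e4 : 2 * N + a + b + 2 * s * Z = b * a + 1 + 2 * b * W.
  apply/eqP; rewrite -(eqn_pmul2l a_gt0); apply/eqP; move: e4.
  by case: (a) a_gt0 => // a' _ /=; lia.
have := congr1 (GRing.natmul (1%R : rat)) e4.
rewrite !(GRing.natrD, GRing.natrM) => {}e4; lra.
Qed.

(** * Sums of indicators and of quotients *)

Lemma sum_ltnM_ord a n (F : nat -> nat) :
  \sum_(t < a) (t < n) * F t = \sum_(t < minn n a) F t.
Proof.
elim: a => [|a IH]; first by rewrite minn0 !big_ord0.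
rewrite big_ord_recr /= IH; case: (ltnP a n) => [an|na].
  rewrite mul1n (_ : minn n a.+1 = a.+1) ?(_ : minn n a = a) ?big_ord_recr //; lia.
by rewrite mul0n addn0 (_ : minn n a.+1 = n) ?(_ : minn n a = n) //; lia.
Qed.

Lemma sum_ltn_ord a n : \sum_(t < a) (t < n) = minn n a.
Proof.
have := sum_ltnM_ord a n (fun=> 1); rewrite sum_nat_const card_ord muln1 => <-.
by apply: eq_bigr => t _; rewrite muln1.
Qed.

(** Induction on q: the first K quotients vanish, and removing them lowers each later one by 1. The
    value r = K is allowed because the last block then simply is complete. *)
Lemma sum_divn K q r : 0 < K -> r <= K ->
  2 * (\sum_(t < q * K + r) t %/ K) + q * K = q * q * K + 2 * q * r.
Proof.
move=> K_gt0 rK; elim: q => [|q IH].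
  rewrite big1 // => t _; apply: divn_small.
  exact: leq_trans (ltn_ord t) rK.
rewrite [q.+1 * K]mulSn -[K + _ + r]addnA big_split_ord /= big1 => [|t _]; last
  by apply: divn_small; apply: ltn_ord.
under eq_bigr => t _ do rewrite divnDl // divnn K_gt0.
rewrite big_split /= sum_nat_const card_ord; move: IH.
by move: (\sum_(_ < _) _) => S; nia.
Qed.

(** * The case p = 3, according to the size of K relative to a *)

(** When K is this large, a positive z forces w so high that its value is never below 3 b; the four
    smallest pairs are (0, 0), ..., (3, 0). *)
Lemma sylvester3_large a b c K s :
    0 < a -> 0 < b -> 0 < c -> coprime a b -> c + s * a = K * b ->
    4 * a <= K -> 2 * s <= K -> 5 * a <= 2 * b ->
  exists N, is_sylvester_number 3 [:: a; b; c] N /\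
    (N%:R = (a%:R - 1) * (b%:R - 1) / 2 + (3 * a)%:R * b%:R :> rat)%R.
Proof.
move=> a_gt0 b_gt0 c_gt0 co cE aK sK ab.
have [t ta|N [HN NE]] := @sylvester_pairs 3 a b c K s (fun=> (3, 0))
  (fun=> [:: (0, 0); (1, 0); (2, 0)]) a_gt0 b_gt0 c_gt0 co cE.
- split=> //.
  + by move=> u; rewrite !inE => /or4P[] /eqP -> /=; lia.
  + by move=> u; rewrite !inE => /or3P[] /eqP -> /=; lia.
  case=> w [|z] /=.
    rewrite !muln0 !addn0 => _; rewrite ltn_pmul2r //.
    by case: w => [|[|[]]].
  move: z.+1 (ltn0Sn z) => {}z z_gt0 valid; rewrite muln0 addn0 => lt; exfalso.
  have w4 : 4 * z <= w by nia.
  (* If s <= b, then w b - s z >= 3 z b already contradicts [lt]. If b < s, then K >= 2 s > 2 b >= 5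
     a and c = K b - s a >= 4 K b / 5 >= 4 a b, while eliminating w gives c z < t b + 3 a b < 4 a
     b. *)
  have [sb|bs] := leqP s b; first by nia.
  have K5 : 5 * a <= K by lia.
  have c4 : 4 * a * b <= c by nia.
  have : K * z * b <= (t + a * w) * b by rewrite leq_mul2r valid orbT.
  have : w * b * a < (3 * b + s * z) * a by rewrite ltn_pmul2r.
  nia.
exists N; split=> //.
by rewrite NE !sum_nat_const card_ord /= muln0 [3 * a]mulnC GRing.mulr0 GRing.subr0.
Qed.

(** With K = a and t < a, the admissible pairs are those with z <= w. The three with w < 2 come
    first; [2 * s <= b] places (1, 0) no higher than (2, 2). *)
Lemma sylvester3_equal a b c s :
    0 < a -> 0 < b -> 0 < c -> coprime a b -> c + s * a = a * b -> 2 * s <= b ->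
  exists N, is_sylvester_number 3 [:: a; b; c] N /\
    (N%:R = (a%:R - 1) * (b%:R - 1) / 2 + (2 * a)%:R * b%:R - s%:R * (2 * a)%:R :> rat)%R.
Proof.
move=> a_gt0 b_gt0 c_gt0 co cE sb.
have [t ta|N [HN NE]] := @sylvester_pairs 3 a b c a s (fun=> (2, 2))
  (fun=> [:: (0, 0); (1, 1); (1, 0)]) a_gt0 b_gt0 c_gt0 co cE.
- split=> //.
  + by move=> u; rewrite !inE => /or4P[] /eqP -> /=; lia.
  + by move=> u; rewrite !inE => /or3P[] /eqP -> /=; lia.
  move=> [w z] /= valid lt.
  have zw : z <= w by nia.
  have w2 : w < 2 by nia.
  by case: w w2 zw {valid lt} => [|[|//]] _; case: z => [|[|z]].
by exists N; split=> //; rewrite NE !sum_nat_const card_ord [2 * a]mulnC.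
Qed.

(* The case k = i - 1, where t %/ K <= 1 and 1 <= (t + a) %/ K <= 3. *)
Lemma sylvester3_one a b c K s :
    0 < a -> 0 < b -> 0 < c -> coprime a b -> c + s * a = K * b ->
    K < a -> a < 2 * K -> 3 * K <= 2 * a -> 8 * s <= b ->
  exists N, is_sylvester_number 3 [:: a; b; c] N /\
    (N%:R = (a%:R - 1) * (b%:R - 1) / 2 + (2 * K)%:R * b%:R - s%:R * (2 * K)%:R :> rat)%R.
Proof.
move=> a_gt0 b_gt0 c_gt0 co cE Ka aK Ka2 sb.
(* For t < a, the pair (1, 2) is admissible from t = 2 K - a on, (0, 1) from t = K on and (1, 3)
   from t = 3 K - a on; (2, 3) always is, because 3 K <= 2 a. *)
pose q t := if t < 2 * K - a then (2, 3) else if t < K then (1, 0) else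
  if t < 3 * K - a then (1, 1) else (1, 2).
pose L t := if t < 2 * K - a then [:: (0, 0); (1, 1); (1, 0)] else
  if t < K then [:: (0, 0); (1, 2); (1, 1)] else
  if t < 3 * K - a then [:: (0, 0); (0, 1); (1, 2)] else [:: (0, 0); (0, 1); (1, 3)].
have [t ta|N [HN NE]] := @sylvester_pairs 3 a b c K s q L a_gt0 b_gt0 c_gt0 co cE.
(* For w >= 3, K z < a (w + 1) and a < 2 K give z <= 2 w + 1 <= 7 (w - 2), so s z <= b (w - 2) by
   [8 * s <= b]: such a pair cannot lie below (2, e). *)
- have big w z e : K * z <= t + a * w -> 2 <= w -> w * b + s * e < 2 * b + s * z ->
      w = 2 /\ e < z.
    move=> valid w2 lt; have [w3|w3] := ltnP 2 w.
      have : K * z * s <= (t + a * w) * s by rewrite leq_mul2r valid orbT.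
      have : (w * b + s * e) * K < (2 * b + s * z) * K by rewrite ltn_pmul2r //; lia.
      nia.
    have -> : w = 2 by lia.
    by split=> //; nia.
  rewrite /q /L; case: ltnP => t1; last (case: ltnP => t2; last (case: ltnP => t3)).
  + split=> //.
    * by move=> u; rewrite !inE => /or4P[] /eqP -> /=; lia.
    * by move=> u; rewrite !inE => /or3P[] /eqP -> /=; lia.
    move=> [w z] /= valid lt.
    have [w2|w2] := ltnP 1 w.
      by have [ew ez] := big w z 3 valid w2 lt; nia.
    case: w w2 valid lt => [|[|//]] _ valid _.
      by case: z valid => // z; nia.
    by case: z valid => [|[|z]] //; nia.
  + split=> //.
    * by move=> u; rewrite !inE => /or4P[] /eqP -> /=; lia.
    * by move=> u; rewrite !inE => /or3P[] /eqP -> /=; lia.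
    move=> [w z] /= valid lt.
    have [w2|w2] := ltnP 1 w; first by nia.
    case: w w2 valid lt => [|[|//]] _ valid lt.
      by case: z valid {lt} => // z; nia.
    by case: z valid lt => [|[|[|z]]] //; nia.
  + split=> //.
    * by move=> u; rewrite !inE => /or4P[] /eqP -> /=; lia.
    * by move=> u; rewrite !inE => /or3P[] /eqP -> /=; lia.
    move=> [w z] /= valid lt.
    have [w2|w2] := ltnP 1 w; first by nia.
    case: w w2 valid lt => [|[|//]] _ valid lt.
      by case: z valid {lt} => [|[|z]] //; nia.
    by case: z valid lt => [|[|[|z]]] //; nia.
  split=> //.
  * by move=> u; rewrite !inE => /or4P[] /eqP -> /=; lia.
  * by move=> u; rewrite !inE => /or3P[] /eqP -> /=; lia.
  move=> [w z] /= valid lt.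
  have [w2|w2] := ltnP 1 w; first by nia.
  case: w w2 valid lt => [|[|//]] _ valid lt.
    by case: z valid {lt} => [|[|z]] //; nia.
  by case: z valid lt => [|[|[|[|z]]]] //; nia.
exists N; split=> //; rewrite NE.
have -> : \sum_(t < a) (q t).1 = 2 * K.
  transitivity (\sum_(t < a) (1 + (t < 2 * K - a))).
    by apply: eq_bigr => t _; rewrite /q; do 3 case: ifP => //= _.
  by rewrite big_split /= sum_nat_const card_ord sum_ltn_ord; lia.
have -> : \sum_(t < a) (q t).2 = 2 * K; last lra.
have : \sum_(t < a) ((q t).2 + (t < K) + (t < 3 * K - a)) = \sum_(t < a) (2 + 3 * (t < 2 * K - a)).
  by apply: eq_bigr => t _; rewrite /q; do 3 case: ltnP => //= ?; lia.
rewrite !big_split /= !sum_nat_const !card_ord !sum_ltn_ord; lia.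
Qed.

(** Let j = t %/ K and M = (t + a) %/ K be the largest z for w = 0 and w = 1. In increasing order of
    value the pairs start with (0, j), ..., (0, 0), then (1, M), (1, M - 1), ...; the fourth is (0,
    j - 3) if j >= 3 and (1, M + j - 2) otherwise. *)
Lemma sylvester3_small a b c K s :
    0 < K -> 0 < c -> coprime a b -> c + s * a = K * b ->
    2 * K <= a -> 2 * s <= K -> 2 * a <= b ->
  exists N Z, [/\ is_sylvester_number 3 [:: a; b; c] N,
    Z + 3 * a = \sum_(t < a + minn (3 * K) a) t %/ K + minn (3 * K) a &
    (N%:R = (a%:R - 1) * (b%:R - 1) / 2 + (minn (3 * K) a)%:R * b%:R
            - s%:R * Z%:R :> rat)%R].
Proof.
move=> K_gt0 c_gt0 co cE Ka sK ab.
have a_gt0 : 0 < a by lia.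
have b_gt0 : 0 < b by lia.
have cK : a * K <= c by nia.
pose q t := if 3 <= t %/ K then (0, t %/ K - 3) else (1, (t + a) %/ K + t %/ K - 2).
pose L t := let j := t %/ K in let M := (t + a) %/ K in
  if 3 <= j then [:: (0, j - 2); (0, j - 1); (0, j)] else
  if j == 0 then [:: (0, 0); (1, M - 1); (1, M)] else
  if j == 1 then [:: (0, 0); (0, 1); (1, M)] else [:: (0, 0); (0, 1); (0, 2)].
have [t ta|N [HN NE]] := @sylvester_pairs 3 a b c K s q L a_gt0 b_gt0 c_gt0 co cE.
- rewrite /q /L.
  have j1 : K * (t %/ K) <= t by rewrite mulnC leq_divM.
  have j2 : t < K * (t %/ K) + K by rewrite -mulnSr mulnC ltn_ceil.
  have M1 : K * ((t + a) %/ K) <= t + a by rewrite mulnC leq_divM.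
  have M2 : t + a < K * ((t + a) %/ K) + K by rewrite -mulnSr mulnC ltn_ceil.
  move: (t %/ K) ((t + a) %/ K) j1 j2 M1 M2 => j M j1 j2 M1 M2.
  (* [Mj] keeps [M - 2] from truncating; [Ms], with a < b, places every pair with w = 1 above all
     those with w = 0. *)
  have Mj : j + 2 <= M by nia.
  have Ms : s * M <= a by nia.
  (* Both tails follow from K (w b - s z) >= w c - s t. *)
  have tail w z e : K * z <= t + a * w -> 0 < w -> w * b + s * e < s * z ->
      j <= e + 3 -> False.
    move=> valid w_gt0 lt je.
    have : K * z * s <= (t + a * w) * s by rewrite leq_mul2r valid orbT.
    have : (w * b + s * e) * K < s * z * K by rewrite ltn_pmul2r.
    have : a * K * w <= c * w by rewrite leq_mul2r cK orbT.
    have : t * s <= K * (e + 4) * s.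
      by rewrite leq_mul // (leq_trans (ltnW j2)) // -mulnSr leq_mul //; lia.
    (* The two preceding bounds leave w c < 4 s K, whereas c >= a K and a >= 2 K >= 4 s. *)
    have : 4 * s * K * 1 <= a * K * w by rewrite !leq_mul //; lia.
    have := congr1 (muln w) cE; clear; nia.
  have tail2 w z e : K * z <= t + a * w -> 1 < w -> w * b + s * e < b + s * z ->
      M <= e + 2 -> False.
    case: w => // v valid v_gt0 lt Me.
    have : K * z * s <= (t + a * v.+1) * s by rewrite leq_mul2r valid orbT.
    have : (v.+1 * b + s * e) * K < (b + s * z) * K by rewrite ltn_pmul2r.
    have : a * K * v <= c * v by rewrite leq_mul2r cK orbT.
    have : (t + a) * s <= K * (e + 3) * s.
      by rewrite leq_mul // (leq_trans (ltnW M2)) // -mulnSr leq_mul //; lia.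
    have : 4 * s * K * 1 <= a * K * v by rewrite !leq_mul //; lia.
    have := congr1 (muln v) cE; clear; nia.
  have z0 z : K * z <= t + a * 0 -> z <= j.
    by rewrite muln0 addn0 => valid; rewrite -ltnS -(ltn_pmul2l K_gt0) mulnSr (leq_ltn_trans valid).
  have z1 z e : K * z <= t + a * 1 -> 1 * b + s * e < 1 * b + s * z -> e < z <= M.
    rewrite ltn_add2l ltn_mul2l muln1 => valid /andP[_ ->] /=.
    by rewrite -ltnS -(ltn_pmul2l K_gt0) mulnSr (leq_ltn_trans valid).
  have [j3|j3] := ltnP 2 j.
    split=> //.
    + by rewrite /= !inE -!pair_eqE /pair_eq /=; lia.
    + by move=> u; rewrite !inE => /or4P[] /eqP -> /=; nia.
    + by move=> u; rewrite !inE => /or3P[] /eqP -> /=; nia.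
    move=> [w z] /= valid lt; case: w valid lt => [|w] valid lt; last first.
      by case: (tail w.+1 z (j - 3) valid) => //; lia.
    have zj := z0 z valid.
    have jz : j - 3 < z by nia.
    by rewrite !inE -!pair_eqE /pair_eq /=; lia.
  case: j j1 j2 Mj tail z0 j3 => [|[|[|//]]] j1 j2 Mj tail z0 _ /=.
  + split=> //.
    * by rewrite /= !inE -!pair_eqE /pair_eq /=; lia.
    * by move=> u; rewrite !inE => /or4P[] /eqP -> /=; nia.
    * by move=> u; rewrite !inE => /or3P[] /eqP -> /=; nia.
    move=> [w z] /= valid lt; rewrite !inE -!pair_eqE /pair_eq /=.
    case: w valid lt => [|[|w]] valid lt.
    * by have := z0 z valid; lia.
    * by have := z1 z _ valid lt; lia.
    by case: (tail2 w.+2 z (M + 0 - 2) valid) => //; lia.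
  + split=> //.
    * by rewrite /= !inE -!pair_eqE /pair_eq /=; lia.
    * by move=> u; rewrite !inE => /or4P[] /eqP -> /=; nia.
    * by move=> u; rewrite !inE => /or3P[] /eqP -> /=; nia.
    move=> [w z] /= valid lt; rewrite !inE -!pair_eqE /pair_eq /=.
    case: w valid lt => [|[|w]] valid lt.
    * by have := z0 z valid; lia.
    * by have := z1 z _ valid lt; lia.
    by case: (tail2 w.+2 z (M + 1 - 2) valid) => //; lia.
  + split=> //.
    * by move=> u; rewrite !inE => /or4P[] /eqP -> /=; nia.
    * by move=> u; rewrite !inE => /or3P[] /eqP -> /=; nia.
    move=> [w z] /= valid lt; rewrite !inE -!pair_eqE /pair_eq /=.
    case: w valid lt => [|[|w]] valid lt.
    * by have := z0 z valid; lia.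
    * by have := z1 z _ valid lt; lia.
    by case: (tail2 w.+2 z (M + 2 - 2) valid) => //; lia.
exists N, (\sum_(t < a) (q t).2); split=> //.
  (* Adding 3 removes the truncated subtractions. The terms (t + a) %/ K, present for t < 3 K only,
     then prolong the sum of t %/ K beyond t = a. *)
  have : \sum_(t < a) ((q t).2 + 3) = \sum_(t < a) (t %/ K + (t < 3 * K) * ((t + a) %/ K + 1)).
    apply: eq_bigr => t _; rewrite /q leq_divRL //; have [h|h] := leqP (3 * K) t; last first.
      have : 2 <= (t + a) %/ K by rewrite leq_divRL //; lia.
      by move: (t %/ K) ((t + a) %/ K) => j M /=; lia.
    have : 3 <= t %/ K by rewrite leq_divRL.
    by move: (t %/ K) => j /=; lia.
  rewrite !big_split /= sum_nat_const card_ord mulnC => ->.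
  rewrite big_split_ord /= -addnA; congr (_ + _).
  rewrite (sum_ltnM_ord a (3 * K) (fun t => (t + a) %/ K + 1)) big_split /=.
  rewrite sum_nat_const card_ord muln1; congr (_ + _).
  by apply: eq_bigr => t _; rewrite addnC.
rewrite NE; have -> // : \sum_(t < a) (q t).1 = minn (3 * K) a.
rewrite -sum_ltn_ord; apply: eq_bigr => t _.
by rewrite /q leq_divRL // ltnNge; case: (_ <= _).
Qed.

(** * Fibonacci identities and inequalities *)

Lemma fibSS n : fib n.+2 = fib n.+1 + fib n.
Proof. by []. Qed.

(** Both sides satisfy the Fibonacci recurrence in m, so two consecutive values of m are carried
    through the induction. With k = m + 2 this is the relation c + s a = K b. *)
Lemma fib_add i m : fib (i + m.+2) + fib m * fib i = fib m.+2 * fib (i + 2).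
Proof.
suff: fib (i + m.+2) + fib m * fib i = fib m.+2 * fib (i + 2) /\
  fib (i + m.+3) + fib m.+1 * fib i = fib m.+3 * fib (i + 2) by case.
elim: m => [|m [IH1 IH2]]; first by rewrite !addnS !addn0 !fibSS (_ : fib 0 = 0) //
    (_ : fib 1 = 1) //; lia.
have e : fib (i + m.+4) = fib (i + m.+3) + fib (i + m.+2) by rewrite !addnS.
by split=> //; rewrite (fibSS m.+2) mulnDl -IH1 -IH2 e (fibSS m) mulnDl addnACA.
Qed.

Lemma coprime_fibS n : coprime (fib n) (fib n.+1).
Proof.
by elim: n => // n IH; rewrite fibSS /coprime gcdnDl gcdnC.
Qed.

Lemma coprime_fib2 n : coprime (fib n) (fib (n + 2)).
Proof. by rewrite addn2 fibSS /coprime gcdnDr; apply: coprime_fibS. Qed.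

Lemma fib_gt0 n : 0 < n -> 0 < fib n.
Proof. by case: n => // n _; elim: n => // n IH; rewrite fibSS addn_gt0 IH. Qed.

Lemma leq_fib m n : m <= n -> fib m <= fib n.
Proof.
move/subnKC <-; elim: (n - m) => [|d IH]; first by rewrite addn0.
by apply: leq_trans IH _; rewrite addnS; case: (m + d) => // k; rewrite fibSS leq_addr.
Qed.

(** * Specialisation to Fibonacci triples *)

Import GRing.Theory Num.Theory.
Local Open Scope ring_scope.

Theorem theorem12 (i k : nat) : (3 <= i)%N -> (3 <= k)%N ->
  [/\
   (* (a) *)
   ((i + 3 <= k)%N ->
     exists N, is_sylvester_number 3 [:: fib i; fib (i + 2); fib (i + k)] N /\
       (N%:R : rat) =
         (7 * (fib i)%:R * (fib (i + 2))%:R - (fib i)%:R - (fib (i + 2))%:R + 1) / 2),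
   (* (b) *)
   (exists N, is_sylvester_number 3 [:: fib i; fib (i + 2); fib (2 * i)] N /\
       (N%:R : rat) =
         ((5 * (fib i)%:R - 1) * (fib (i + 2))%:R - (fib i)%:R + 1) / 2
         - 2 * (fib i)%:R * (fib (i - 2))%:R),
   (* (c) *)
   ((4 <= i)%N ->
     exists N, is_sylvester_number 3 [:: fib i; fib (i + 2); fib (2 * i - 1)] N /\
       (N%:R : rat) =
         (((fib i)%:R + 4 * (fib (i - 1))%:R - 1) * (fib (i + 2))%:R - (fib i)%:R + 1) / 2
         - 2 * (fib (i - 1))%:R * (fib (i - 3))%:R),
   (* (d) *)
   ((5 <= i)%N ->
     exists N, is_sylvester_number 3 [:: fib i; fib (i + 2); fib (2 * i - 2)] N /\
       (N%:R : rat) =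
         ((3 * (fib i)%:R - 1) * (fib (i + 2))%:R - (fib i)%:R + 1) / 2
         - (8 * (fib i)%:R - 15 * (fib (i - 2))%:R) * (fib (i - 4))%:R)
   &
   (* (e) *)
   (let r := ((fib i - 1) %/ fib k)%N in
    (3 <= r)%N ->
     exists N, is_sylvester_number 3 [:: fib i; fib (i + 2); fib (i + k)] N /\
       (N%:R : rat) =
         (((fib i)%:R + 6 * (fib k)%:R - 1) * (fib (i + 2))%:R - (fib i)%:R + 1) / 2
         - (2 * r%:R * (fib i)%:R
            - (r%:R + 4) * (r%:R - 3) * (fib k)%:R) * (fib (k - 2))%:R / 2)].
Proof.
move=> i3 k3.
have a_gt0 : (0 < fib i)%N by apply: fib_gt0; lia.
have b_gt0 : (0 < fib (i + 2))%N by apply: fib_gt0; lia.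
have c_gt0 m : (0 < fib (i + m))%N by apply: fib_gt0; lia.
have co := coprime_fib2 i.
have cE m : (2 <= m)%N -> (fib (i + m) + fib (m - 2) * fib i = fib m * fib (i + 2))%N.
  by case: m => [|[|m]] // _; rewrite !subSS subn0 fib_add.
have le m : (fib m <= fib m.+1)%N by apply: leq_fib.
have pos m : (0 < fib m.+1)%N by apply: fib_gt0.
(* The five cases are K >= 4 a, K = a (k = i), k = i - 1, k = i - 2 and 3 K <= a. The last two share
   [sylvester3_small], with minn (3 K) a equal to a and to 3 K respectively. *)
split.
- move=> ik.
  have ss : (2 * fib (k - 2) <= fib k)%N.
    by case: k k3 {ik} => [|[|m]] // _; rewrite !subSS subn0 fibSS; have := le m; lia.
  have aK : (4 * fib i <= fib k)%N.
    apply: leq_trans (leq_fib ik).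
    by case: i i3 {a_gt0 b_gt0 c_gt0 co cE ik} => [|[|n]] // _;
      rewrite addn3 !fibSS; have := le n; lia.
  have ab : (5 * fib i <= 2 * fib (i + 2))%N.
    by case: i i3 {a_gt0 b_gt0 c_gt0 co cE ik aK} => [|[|n]] // _;
      rewrite addn2 !fibSS; have := le n; lia.
  have [|N [HN NE]] := sylvester3_large a_gt0 b_gt0 (c_gt0 k) co (cE k _) aK ss ab; first lia.
  by exists N; split=> //; rewrite NE natrM; field.
- have ss : (2 * fib (i - 2) <= fib (i + 2))%N.
    by have := leq_fib (leq_subr 2 i); have := leq_fib (leq_addr 2 i);
       case: i i3 {a_gt0 b_gt0 c_gt0 co cE} => [|[|n]] // _; rewrite !subSS subn0 addn2 !fibSS; lia.
  have [|N [HN NE]] := sylvester3_equal a_gt0 b_gt0 (c_gt0 i) co (cE i _) ss; first lia.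
  by exists N; split; [rewrite mul2n -addnn | rewrite NE natrM; field].
- move=> i4.
  have [n ni] : exists n, i = n.+4 by exists (i - 4)%N; lia.
  have [|||||N [HN NE]] := sylvester3_one a_gt0 b_gt0 (c_gt0 (i - 1)%N) co (cE (i - 1)%N _).
  + lia.
  + by rewrite ni !subSS !subn0 !fibSS; have := pos n; have := pos n.+1; lia.
  + by rewrite ni !subSS !subn0 !fibSS; have := pos n; lia.
  + by rewrite ni !subSS !subn0 !fibSS; have := le n; lia.
  + by rewrite ni !subSS !subn0 addn2 !fibSS; have := le n; lia.
  exists N; split; first by rewrite (_ : (2 * i - 1 = i + (i - 1))%N) //; lia.
  by rewrite NE natrM (_ : (i - 1 - 2 = i - 3)%N); [field | lia].
- move=> i5.
  have [n ni] : exists n, i = n.+1.+4 by exists (i - 5)%N; lia.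
  have [|||||N [Z [HN ZE NE]]] :=
      sylvester3_small _ (c_gt0 (i - 2)%N) co (cE (i - 2)%N _); rewrite ?fib_gt0; try lia.
  + by rewrite ni !subSS !subn0 !fibSS; lia.
  + by rewrite ni !subSS !subn0 !fibSS; have := le n; lia.
  + by rewrite ni addn2 !fibSS; lia.
  (* The sum of quotients runs up to 2 F_i, which is 5 F_(i-2) + F_(i-5): five full blocks and a
     remainder. *)
  have r1 : (5 * fib (i - 2) + fib n = 2 * fib i)%N.
    by rewrite ni !subSS !subn0 !fibSS; lia.
  have r2 : (fib n <= fib (i - 2))%N by apply: leq_fib; lia.
  have r3 : (fib i <= 3 * fib (i - 2))%N.
    by rewrite ni !subSS !subn0 !fibSS; have := le n; lia.
  have := @sum_divn (fib (i - 2)) 5 (fib n) _ r2; rewrite fib_gt0 ?r1; last lia.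
  move=> /(_ isT) SE; move: ZE; rewrite (minn_idPr r3) addnn -mul2n => ZE.
  have {}ZE : (Z + 15 * fib (i - 2) = 8 * fib i)%N by lia.
  exists N; split; first by rewrite (_ : (2 * i - 2 = i + (i - 2))%N) //; lia.
  have ZR : Z%:R = 8 * (fib i)%:R - 15 * (fib (i - 2))%:R :> rat.
    by apply: (addIr (15 * (fib (i - 2))%:R)); rewrite subrK -!natrM -natrD ZE.
  rewrite NE ZR (minn_idPr r3) (_ : (i - 2 - 2 = i - 4)%N); [by field | lia].
move=> r r3.
have K_gt0 : (0 < fib k)%N by apply: fib_gt0; lia.
(* As r is the quotient of F_i - 1, the remainder p ranges over 1, ..., F_k instead of 0, ..., F_k -
   1. *)
have [p aE pK] : exists2 p, (fib i = r * fib k + p)%N & (p <= fib k)%N.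
  exists ((fib i - 1) %% fib k).+1; last by rewrite ltn_pmod.
  by rewrite addnS -divn_eq; lia.
have ka : (3 * fib k <= fib i)%N.
  by rewrite aE; apply: leq_trans (leq_addr _ _); rewrite leq_mul2r r3 orbT.
have [||||N [Z [HN ZE NE]]] := sylvester3_small K_gt0 (c_gt0 k) co (cE k _).
- lia.
- lia.
- by case: k k3 {K_gt0 r r3 aE pK ka} => [|[|m]] // _;
    rewrite !subSS subn0 fibSS; have := le m; lia.
- by rewrite addn2 fibSS; have := le i; lia.
have := sum_divn (r + 3) K_gt0 pK.
have -> : ((r + 3) * fib k + p = fib i + 3 * fib k)%N by rewrite aE; lia.
move: ZE; rewrite (minn_idPl ka); move: (\sum_(t < _) _)%N => S ZE SE.
have ZR : Z%:R = (2 * r%:R * (fib i)%:R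
                  - (r%:R + 4) * (r%:R - 3) * (fib k)%:R) / 2 :> rat.
  have := congr1 (GRing.natmul (1 : rat)) ZE; have := congr1 (GRing.natmul (1 : rat)) SE.
  have := congr1 (GRing.natmul (1 : rat)) aE.
  rewrite !(natrD, natrM).
  move: (r%:R : rat) (Z%:R : rat) ((fib i)%:R : rat) ((fib k)%:R : rat) (p%:R : rat)
    => R' Z' A' K' P'.
  move: (S%:R : rat) => S' e1 e2 e3.
  have -> : Z' = S' + 3 * K' - 3 * A' by rewrite -[Z'](addrK (3 * A')) e3; ring.
  have -> : S' = ((R' + 3) * (R' + 3) * K' + 2 * (R' + 3) * P' - (R' + 3) * K') / 2.
    by rewrite -e2; field.
  have -> : P' = A' - R' * K' by rewrite e1; ring.
  by field.
by exists N; split=> //; rewrite NE ZR (minn_idPl ka) natrM; field.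
Qed.
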